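(* Let $v=s_2s_4s_3$. Then the GIT quotient $T\backslash\!\backslash (X^{v}_{w_{3,7}})^{ss}_T(\mathcal{L}(7\omega_3))$ is a point.
   Context: $G=SL(7,\mathbb{C})$, $T$ is the subgroup of diagonal matrices, $B$ (resp. $B^-$) the subgroup of upper (resp. lower) triangular matrices, $s_i=(i,i+1)\in S_7$, and $G_{3,7}$ is the Grassmannian of $3$-dimensional subspaces of $\mathbb{C}^7$. A minimal-length coset representative $w\in S_7$ (one with $w(1)<w(2)<w(3)$ and $w(4)<\dots<w(7)$) is identified with $[w(1),w(2),w(3)]$; e.g. $s_2s_4s_3$ corresponds to $[1,3,5]$. Put $e_w=[e_{w(1)}\wedge e_{w(2)}\wedge e_{w(3)}]$; $X(w)$ is the closure of $Be_w$, $X^v$ the closure of $B^-e_v$, $X^v_w=X(w)\cap X^v$, and $w_{3,7}=[3,5,7]$. $\mathcal{L}(\omega_3)$ is the pullback of $\mathcal{O}(1)$ under the Plücker embedding with its natural $T$-linearization, and $\mathcal{L}(7\omega_3)=\mathcal{L}(\omega_3)^{\otimes7}$. The semistable locus $X^{ss}_T(\mathcal{L})$ is the set of points of $X$ at which some $T$-invariant section over $X$ of a positive power of $\mathcal{L}$ does not vanish, and the GIT quotient is $T\backslash\!\backslash X^{ss}_T(\mathcal{L})=\mathrm{Proj}\bigoplus_{m\ge0}H^0(X,\mathcal{L}^{\otimes m})^T$. *)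

(* Defs.v *)
From HB Require Import structures.
From mathcomp Require Import all_boot all_order all_algebra all_fingroup.
From mathcomp Require Import mpoly complex.
From mathcomp Require Import boolp classical_sets functions reals.

Set Implicit Arguments.
Unset Strict Implicit.
Unset Printing Implicit Defensive.

Import GRing.Theory.
Local Open Scope classical_set_scope.
Local Open Scope ring_scope.

(** * Proj of a graded ring

   A graded ring is given by the homogeneous components [S m] (m : nat) inside
   an ambient commutative ring [A]: [S m] is an additive subgroup, [1] is in
   [S 0], [S i * S j] is contained in [S (i + j)], and the sum of the [S m] is
   direct.  The graded ring itself is [graded_sum S], the sum of the [S m]. *)

Definition graded_sum (A : comPzRingType) (S : nat -> set A) : set A :=
  [set a | exists n (f : nat -> A),
     (forall m, S m (f m)) /\ a = \sum_(m < n) f m].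

Record homogeneous_prime (A : comPzRingType) (S : nat -> set A) (p : set A) :
    Prop := HomogeneousPrime {
  hprime_sub : p `<=` graded_sum S;
  hprime0 : p 0;
  hprimeD : forall a b, p a -> p b -> p (a + b);
  hprimeM : forall a b, graded_sum S a -> p b -> p (a * b);
  hprime_homog : forall n (f : nat -> A), (forall m, S m (f m)) ->
    p (\sum_(m < n) f m) -> forall m, (m < n)%N -> p (f m);
  hprime1 : ~ p 1;
  hprime_prime : forall a b, graded_sum S a -> graded_sum S b ->
    p (a * b) -> p a \/ p b }.

(* Homogeneous primes that do not contain the irrelevant ideal. *)
Definition Proj (A : comPzRingType) (S : nat -> set A) : set (set A) :=
  [set p | homogeneous_prime S p /\
     exists m a, [/\ (0 < m)%N, S m a & ~ p a]].

(* The stalk of the structure sheaf of Proj at p is the degree-0 part of the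
   localization at the homogeneous elements outside p: it consists of the
   fractions a / b with a, b in the same [S m] and b outside p.  This is the
   equality a / b = a' / b' there. *)
Definition stalk_eq (A : comPzRingType) (S : nat -> set A) (p : set A)
    (a b a' b' : A) : Prop :=
  exists n h, [/\ S n h, ~ p h & h * (a * b') = h * (a' * b)].

(* Proj is isomorphic to Spec K as a K-scheme, where K acts through
   [incl : K -> S 0].  A scheme whose space is a single point is the spectrum
   of its only stalk, so the condition is that there is exactly one point and
   that K maps bijectively onto the stalk at that point. *)
Definition Proj_is_point (K : fieldType) (A : comPzRingType) (incl : K -> A)
    (S : nat -> set A) : Prop :=
  exists p, [/\ Proj S p,
    forall q, Proj S q -> q = p &
    forall m a b, S m a -> S m b -> ~ p b ->
      exists! c : K, stalk_eq S p a b (incl c) 1].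

(** * The Grassmannian in its Pluecker embedding *)

Definition incr (r n : nat) : finType :=
  {t : r.-tuple 'I_n | sorted ltn [seq val i | i <- t]}.

(* The r-th exterior power of K^n, in the basis e_{i_1} /\ ... /\ e_{i_r}
   with i_1 < ... < i_r. *)
Definition ext_power (K : fieldType) (r n : nat) := {ffun incr r n -> K}.

(* M_1 /\ ... /\ M_r for the columns M_j of M. *)
Definition pluecker (K : fieldType) (r n : nat) (M : 'M[K]_(n, r)) :
    ext_power K r n :=
  [ffun I : incr r n => \det (rowsub (tnth (val I)) M)].

(* The action of g on the exterior power: the r-th compound matrix of g. *)
Definition ext_act (K : fieldType) (r n : nat) (g : 'M[K]_n)
    (x : ext_power K r n) : ext_power K r n :=
  [ffun I : incr r n =>
     \sum_J \det (mxsub (tnth (val I)) (tnth (val J)) g) * x J].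

(* From here on, a subset of the projective space P(ext_power K r n) is
   represented by its punctured affine cone: the set of all nonzero vectors
   that represent its points. *)

Definition grassmannian (K : fieldType) (r n : nat) : set (ext_power K r n) :=
  [set x | exists2 M : 'M[K]_(n, r), \rank M = r & x = pluecker M].

(* e_{t_1} /\ ... /\ e_{t_r} *)
Definition ept (K : fieldType) (r n : nat) (t : r.-tuple 'I_n) :
    ext_power K r n :=
  pluecker (\matrix_(i < n, j < r) (i == tnth t j)%:R).

Definition borel (K : fieldType) (n : nat) : set 'M[K]_n :=
  [set b | is_trig_mx b^T /\ \det b = 1].

(* [is_trig_mx] means lower triangular. *)
Definition opp_borel (K : fieldType) (n : nat) : set 'M[K]_n :=
  [set b | is_trig_mx b /\ \det b = 1].

Definition torus (K : fieldType) (n : nat) : set 'M[K]_n :=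
  [set t | is_diag_mx t /\ \det t = 1].

Definition orbit_cone (K : fieldType) (r n : nat) (H : set 'M[K]_n)
    (x : ext_power K r n) : set (ext_power K r n) :=
  [set y | exists h c, [/\ H h, c != 0 & y = [ffun I => c * ext_act h x I]]].

Definition coord_poly (K : fieldType) (r n : nat) := {mpoly K[#|incr r n|]}.

Definition peval (K : fieldType) (r n : nat) (f : coord_poly K r n)
    (x : ext_power K r n) : K :=
  f.@[fun i => x (enum_val i)].

(* Zariski closure in the Grassmannian. *)
Definition zclosure (K : fieldType) (r n : nat) (S : set (ext_power K r n)) :
    set (ext_power K r n) :=
  [set x | grassmannian x /\
     forall d (f : coord_poly K r n), f \is d.-homog ->
       (forall y, S y -> peval f y = 0) -> peval f x = 0].

Definition schubert (K : fieldType) (r n : nat) (w : r.-tuple 'I_n) :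
    set (ext_power K r n) :=
  zclosure (orbit_cone (@borel K n) (ept K w)).

Definition opp_schubert (K : fieldType) (r n : nat) (v : r.-tuple 'I_n) :
    set (ext_power K r n) :=
  zclosure (orbit_cone (@opp_borel K n) (ept K v)).

Definition richardson (K : fieldType) (r n : nat) (v w : r.-tuple 'I_n) :
    set (ext_power K r n) :=
  schubert w `&` opp_schubert v.
Arguments richardson K {r n} v w.

(** * Sections and the GIT quotient *)

(* H^0(X, O(d)) for the reduced subvariety X of projective space: functions
   on the punctured cone of X that are, Zariski locally, quotients f / g of
   homogeneous polynomials with deg f = deg g + d.  (Such a function is
   homogeneous of degree d on the cone.) *)
Definition sections (K : fieldType) (r n : nat) (X : set (ext_power K r n))
    (d : nat) : set (X -> K) :=
  [set s | forall x : X, exists e (f g : coord_poly K r n),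
     [/\ f \is (e + d).-homog, g \is e.-homog, peval g (val x) != 0 &
         forall y : X, peval g (val y) != 0 ->
           s y = peval f (val y) / peval g (val y)]].

(* Invariance for the natural linearization (t . s)(x) = s (t^-1 x). *)
Definition torus_invariant (K : fieldType) (r n : nat)
    (X : set (ext_power K r n)) : set (X -> K) :=
  [set s | forall (t : 'M[K]_n) (x y : X), torus t ->
     val y = ext_act t (val x) -> s y = s x].

(* The degree-m component H^0(X, (O(1)^d)^m)^T.  On the punctured cone,
   nonzero functions of different degrees are linearly independent (K being
   infinite), so the sum of these components inside X -> K is direct. *)
Definition git_ring (K : fieldType) (r n : nat) (X : set (ext_power K r n))
    (d : nat) (m : nat) : set (X -> K) :=
  sections (d * m) `&` @torus_invariant K r n X.

Definition git_quotient_is_point (K : fieldType) (r n : nat)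
    (X : set (ext_power K r n)) (d : nat) : Prop :=
  Proj_is_point (fun c : K => cst c : X -> K) (@git_ring K r n X d).

(** * Indices for G_{3,7} *)

(* Letters 1, ..., 7 are the elements 0, ..., 6 of 'I_7. *)
Definition letter (k : nat) : 'I_7 := inord k.-1.

Definition s_ (i : nat) : 'S_7 := tperm (letter i) (letter i.+1).

(* [w(1), w(2), w(3)] *)
Definition coset_word (w : 'S_7) : 3.-tuple 'I_7 :=
  [tuple w (letter 1); w (letter 2); w (letter 3)].

(* s_2 s_4 s_3 as a composition of functions (s_3 acts first); the product of
   'S_n composes in the opposite order: (s * t) x = t (s x). *)
Definition v_perm : 'S_7 := (s_ 3 * s_ 4 * s_ 2)%g.

Lemma coset_word_v_perm :
  coset_word v_perm = [tuple letter 1; letter 3; letter 5].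
Proof.
have lE i j : (0 < i <= 7)%N -> (0 < j <= 7)%N ->
    (letter i == letter j) = (i == j).
  case: i j => [|i] [|j] //= hi hj.
  by rewrite -val_eqE /= !inordK.
by apply: val_inj; rewrite /= !permM /s_ !permE /= !lE //= !lE.
Qed.

Definition w37 : 3.-tuple 'I_7 := [tuple letter 3; letter 5; letter 7].

(* Main.v *)
Require Import Defs.
From mathcomp Require Import all_boot all_order all_algebra all_fingroup.
From mathcomp Require Import mpoly complex ring zify.
From mathcomp Require Import boolp classical_sets functions reals.

Set Implicit Arguments.
Unset Strict Implicit.
Unset Printing Implicit Defensive.

Import GRing.Theory.
Local Open Scope classical_set_scope.
Local Open Scope ring_scope.

(** The quotient of the Richardson variety [X] by the torus [T] is a point because
    [X] is the closure of a single [T]-orbit, on which some [T]-invariant section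
    does not vanish.

    Such an orbit determines everything ([git_quotient_dense_orbit]).  Let [F] be
    an invariant form of degree [d] with [F x0 <> 0].  An invariant section of
    degree [d * m] is determined on the cone over the orbit of [x0] by its value
    at [x0], and on [X] by density; hence it is a multiple of [F ^+ m].  The
    invariant ring is thus the polynomial ring [K[F]] on one generator of
    positive degree, whose Proj is a point ([Proj_monogenic_is_point]).

    The orbit.  Consider the 7 x 3 matrices whose j-th column is supported on
    the j-th of the intervals {1,2,3}, {3,4,5}, {5,6,7}, with all nine of these
    entries nonzero.  Rows and columns, joined by the nine entries, form a tree;
    so scaling rows and columns makes all the entries 1, and the column spaces
    form one [T]-orbit ([full_band_orbit]).  Such a matrix occupies the columns
    3, 5, 7 of an upper triangular matrix and the columns 1, 3, 5 of a lower
    triangular one; this puts the orbit in [X] ([full_band_richardson]).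

    Density ([richardson_torus_dense]).  On [X] the Pluecker coordinate of
    i_1 < i_2 < i_3 vanishes unless each i_j is in the j-th interval.  Therefore
    a point of [X] is a space [V] with a basis [u], [z], [v], where [u] lies in
    <e_1,e_2,e_3> and [v] in <e_5,e_6,e_7>, and where either [z] has no component
    on e_1, e_2 or [u] is a multiple of e_3, and similarly for [v], e_6, e_7 and
    e_5 ([richardson_basis]).  If both first alternatives hold, then the basis is
    banded, hence a limit of matrices of the orbit.  Otherwise two of the three
    lines in which a generic [V] meets the coordinate spaces of the intervals
    have come together, and an explicit line of matrices degenerates a banded
    matrix to it ([degenerate_in_closure]).

    The invariant form.  A monomial of degree 7 in the Pluecker coordinates is
    invariant when each of the indices 1, ..., 7 occurs three times in it; the
    product of the coordinates 135, 136, 146, 246, 247, 257, 357 is such a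
    monomial, and none of its factors vanishes on the orbit. *)

(** * Determinants and kernels *)

Lemma det_mx33 (R : comNzRingType) (A : 'M[R]_3) :
  \det A = A 0 0 * (A 1 1 * A 2 2 - A 1 2 * A 2 1)
         - A 0 1 * (A 1 0 * A 2 2 - A 1 2 * A 2 0)
         + A 0 2 * (A 1 0 * A 2 1 - A 1 1 * A 2 0).
Proof.
pose B i j := A (inord i) (inord j).
have AE i j : A i j = B i j by rewrite /B !inord_val.
rewrite (expand_det_row _ 0) !big_ord_recl big_ord0 /cofactor.
rewrite !(expand_det_row _ 0) !big_ord_recl !big_ord0 /cofactor !det_mx11 !mxE.
rewrite !AE /= /bump /=.
ring.
Qed.

(** Each permutation sends some index [i >= k] to an index [<= k], so every term
    of the Leibniz formula has a factor in the zero block. *)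
Lemma det_zero_block (K : fieldType) r (A : 'M[K]_r) (k : 'I_r) :
  (forall i j : 'I_r, (k <= i)%N -> (j <= k)%N -> A i j = 0) -> \det A = 0.
Proof.
move=> A0; rewrite /determinant big1 // => s _.
have [i ki sik] : exists2 i : 'I_r, (k <= i)%N & (s i <= k)%N.
  apply/exists_inP; apply: contraT; rewrite negb_exists_in => /forall_inP h.
  have : (#|s @: [set i : 'I_r | (k <= i)%N]%SET| <= #|[set i : 'I_r | (k < i)%N]%SET|)%N.
    apply/subset_leq_card/fintype.subsetP => _ /imsetP[i ki ->].
    by rewrite finset.in_set in ki; rewrite finset.in_set ltnNge h.
  rewrite card_imset; last exact: perm_inj.
  rewrite (_ : [set i : 'I_r | (k <= i)%N]%SET =
    k |: [set i : 'I_r | (k < i)%N]%SET); last first.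
    by apply/finset.setP => i; rewrite !finset.inE leq_eqVlt eq_sym.
  by rewrite cardsU1 finset.in_set ltnn ltnn.
by rewrite (bigD1 i) //= A0 // mul0r mulr0.
Qed.

(** Otherwise [A] would have full column rank, and some [r] of its rows would
    already form an invertible matrix. *)
Lemma minors_eq0_kernel (K : fieldType) m r (A : 'M[K]_(m, r)) :
  (forall g : 'I_r -> 'I_m, injective g -> \det (rowsub g A) = 0) ->
  exists2 c : 'cV_r, c != 0 & A *m c = 0.
Proof.
move=> A0.
have : ~~ row_full A.
  apply/negP => fA; have := fullrowsub_unit fA.
  by rewrite unitmxE A0 ?unitr0 //; exact: fullrankfun_inj.
move=> nfA; have rA : (\rank A < r)%N by rewrite ltn_neqAle nfA rank_leq_col.
have : kermx A^T != 0 by rewrite -mxrank_eq0 mxrank_ker mxrank_tr subn_eq0 -ltnNge.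
case/rowV0Pn => v /sub_kermxP vA v0; exists v^T; first by rewrite trmx_eq0.
by apply: trmx_inj; rewrite trmx_mul trmxK vA trmx0.
Qed.

Lemma parallel_elim (K : fieldType) (a b a' b' : K) : a * b' = a' * b ->
  exists l, (a = 0 /\ a' = 0) \/ (b - l * a = 0 /\ b' - l * a' = 0).
Proof.
move=> e; have [a0|a0] := eqVneq a 0.
  have [a'0|a'0] := eqVneq a' 0; first by exists 0; left.
  exists (b' / a'); right; rewrite a0 divfK // subrr mulr0 subr0; split=> //.
  by apply/eqP; rewrite -(mulrI_eq0 b (mulfI a'0)) -e a0 mul0r.
exists (b / a); right; rewrite divfK // subrr; split=> //.
by rewrite mulrAC [b * a']mulrC -e [a * b']mulrC mulfK // subrr.
Qed.

(** The three coordinates of the cross product of [a] and [b] are, up to sign,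
    the determinants for the basis vectors [c]. *)
Lemma cross_eq0 (K : fieldType) (a b : 'cV[K]_3) :
  (forall c : 'cV_3, \det (\matrix_(i < 3, j < 3) [tuple a i 0; c i 0; b i 0]`_j) = 0) ->
  forall i j, a i 0 * b j 0 = a j 0 * b i 0.
Proof.
move=> d0.
have h k := d0 (\col_i (i == k)%:R).
have := (h 0, h 1, h 2); rewrite !det_mx33 !mxE /=.
rewrite !(mul0r, mulr0, mul1r, mulr1, oppr0, subr0, sub0r, add0r, addr0).
move=> [[h12 h02] h01].
have e12 : a 1 0 * b 2 0 = a 2 0 * b 1 0.
  by apply/eqP; rewrite -subr_eq0 -oppr_eq0 -h12; apply/eqP; ring.
have e02 : a 0 0 * b 2 0 = a 2 0 * b 0 0.
  by apply/eqP; rewrite -subr_eq0 -h02; apply/eqP; ring.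
have e01 : a 0 0 * b 1 0 = a 1 0 * b 0 0.
  by apply/eqP; rewrite -subr_eq0 -oppr_eq0 -h01; apply/eqP; ring.
have I3 (k : 'I_3) : [\/ k = 0, k = 1 | k = 2].
  by case: k => [[|[|[|//]]] k3]; [apply: Or31|apply: Or32|apply: Or33]; apply: val_inj.
by move=> i j; case: (I3 i) => ->; case: (I3 j) => ->.
Qed.

(** * Proj of a polynomial ring in one variable *)

Section MonogenicProj.
Variables (K : fieldType) (X : Type) (sigma : X -> K).
Variable S : nat -> set (X -> K).
Hypothesis S_monomials : forall m s,
  S m s <-> exists c, s = fun x => c * sigma x ^+ m.
Hypothesis sigma_transcendental :
  forall p : {poly K}, (forall x, p.[sigma x] = 0) -> p = 0.

Let incl (c : K) : X -> K := cst c.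

(** By transcendence of [sigma], this makes the graded ring a copy of [{poly K}];
    in particular it is a domain. *)
Lemma graded_sum_poly s :
  graded_sum S s -> exists p : {poly K}, s = fun x => p.[sigma x].
Proof.
move=> [n [f [Sf ->]]].
have [c fc] := choice (fun m => (S_monomials m (f m)).1 (Sf m)).
exists (\poly_(m < n) c m); apply/funext => x.
by rewrite horner_poly fct_sumE; apply: eq_bigr => m _; rewrite fc.
Qed.

Lemma graded_sum_component m s : S m s -> graded_sum S s.
Proof.
move=> Ss; exists m.+1, (fun i => if i == m then s else 0); split=> [i|].
  case: eqP => [-> //|_]; apply/S_monomials; exists 0.
  by apply/funext => x; rewrite mul0r.
rewrite big_ord_recr /= eqxx big1 ?add0r // => i _.
by rewrite ltn_eqF.
Qed.

Lemma graded_sum_domain s t :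
  graded_sum S s -> graded_sum S t -> s * t = 0 -> s = 0 \/ t = 0.
Proof.
move=> /graded_sum_poly[p ->] /graded_sum_poly[q ->] pq0.
have /eqP : p * q = 0.
  by apply: sigma_transcendental => x; rewrite hornerM; exact: (congr1 (@^~ x) pq0).
by rewrite mulf_eq0 => /orP[] /eqP ->; [left|right];
  apply/funext => x; rewrite horner0.
Qed.

Lemma one_neq0 : (1 : X -> K) <> 0.
Proof.
move=> e; have : (1 : {poly K}) = 0.
  by apply: sigma_transcendental => x; rewrite hornerC; exact: (congr1 (@^~ x) e).
by move/eqP; rewrite oner_eq0.
Qed.

Lemma S_cst c : S 0 (incl c).
Proof. by apply/S_monomials; exists c; apply/funext => x; rewrite expr0 mulr1. Qed.

Lemma S_power m : S m (sigma ^+ m).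
Proof. by apply/S_monomials; exists 1; apply/funext => x; rewrite mul1r exprfctE. Qed.

Lemma zero_homogeneous_prime : homogeneous_prime S [set 0].
Proof.
split=> //=.
- by move=> _ ->; exists 0, (fun m => 0); split=> [m|]; rewrite ?big_ord0 //;
    apply/S_monomials; exists 0; apply/funext => x; rewrite mul0r.
- by move=> _ _ -> ->; rewrite addr0.
- by move=> s _ _ ->; rewrite mulr0.
- move=> n f Sf f0 m mn.
  have [c fc] := choice (fun m => (S_monomials m (f m)).1 (Sf m)).
  have p0 : \poly_(m < n) c m = 0.
    apply: sigma_transcendental => x.
    have := congr1 (@^~ x) f0; rewrite fct_sumE horner_poly => fx0.
    by rewrite -[RHS]fx0; apply: eq_bigr => i _; rewrite fc.
  have := congr1 (fun p : {poly K} => p`_m) p0.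
  by rewrite coef_poly mn coef0 fc => ->; apply/funext => x; rewrite mul0r.
- exact: one_neq0.
- exact: graded_sum_domain.
Qed.

(** A homogeneous prime containing a nonzero [c * sigma ^+ m] contains [sigma],
    hence the irrelevant ideal; so only the zero ideal is left. *)
Lemma Proj_monogenic_unique q : Proj S q -> q = [set 0].
Proof.
move=> [hq [m0 [a [m0_gt0 Sa qa]]]].
have sigmaNq : ~ q sigma.
  move=> qs; apply: qa; move/S_monomials: Sa => [c ->].
  rewrite -[m0]prednK // (_ : (fun x => _) = incl c * sigma ^+ m0.-1 * sigma).
    apply: (hprimeM hq) => //; apply: (@graded_sum_component m0.-1).
    by apply/S_monomials; exists c; apply/funext => x; rewrite !fctE.
  by apply/funext => x; rewrite !fctE exprSr mulrA.
have powNq m : ~ q (sigma ^+ m).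
  elim: m => [|m IH]; first by rewrite expr0; exact: (hprime1 hq).
  rewrite exprS => /(hprime_prime hq); case=> //.
    by apply: (@graded_sum_component 1); have := S_power 1; rewrite expr1.
  exact: graded_sum_component (S_power m).
apply/seteqP; split=> [s qs|_ ->]; last exact: hprime0 hq.
have [n [f [Sf sE]]] := hprime_sub hq qs.
rewrite sE big1 // => i _; rewrite sE in qs.
have qf := hprime_homog hq Sf qs (ltn_ord i).
move/S_monomials: (Sf i) => [c fE]; rewrite fE.
have [->|c0] := eqVneq c 0; first by apply/funext => x; rewrite mul0r.
case: (powNq i).
rewrite (_ : sigma ^+ i = incl c^-1 * f i).
  exact: (hprimeM hq) (graded_sum_component (S_cst _)) qf.
by rewrite fE; apply/funext => x; rewrite !fctE mulrA mulVf ?mul1r.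
Qed.

Lemma Proj_monogenic_is_point : Proj_is_point incl S.
Proof.
exists [set 0]; split; last 1 first.
- move=> m a b /S_monomials[c ->] /S_monomials[d ->] b0.
  have d0 : d != 0.
    by apply/eqP => d0; apply: b0; apply/funext => x; rewrite d0 mul0r.
  exists (c / d); split=> [|c' [n [h [Sh h0 heq]]]].
    exists 0, 1; split; [exact: S_cst|exact: one_neq0|].
    by congr (_ * _); apply/funext => x; rewrite !fctE mulr1 mulrA divfK.
  have : h * ((fun x => (c - c' * d) * sigma x ^+ m) : X -> K) = 0.
    apply/funext => x; have := congr1 (@^~ x) heq; rewrite !fctE mulr1 => e.
    by rewrite mulrBl mulrBr e -mulrA subrr.
  move/graded_sum_domain; case=> //.
  + exact: graded_sum_component Sh.
  + by apply: (@graded_sum_component m); apply/S_monomials; exists (c - c' * d).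
  + move=> e; have : (c - c' * d)%:P * 'X ^+ m = 0.
      apply: sigma_transcendental => x.
      by rewrite hornerM hornerC hornerXn; exact: (congr1 (@^~ x) e).
    move/eqP; rewrite mulf_eq0 expf_eq0 polyX_eq0 andbF orbF polyC_eq0 subr_eq0.
    by move/eqP => ->; rewrite mulfK.
- split; first exact: zero_homogeneous_prime.
  exists 1, sigma; split=> //; first by have := S_power 1; rewrite expr1.
  move=> e; have /eqP : 'X = 0 :> {poly K}.
    by apply: sigma_transcendental => x; rewrite hornerX e.
  by rewrite polyX_eq0.
- exact: Proj_monogenic_unique.
Qed.

End MonogenicProj.

(** * Pluecker coordinates and the action on the exterior power *)

Section Pluecker.
Variables (K : fieldType) (r n : nat).
Implicit Types (I J w : incr r n) (x : ext_power K r n) (M : 'M[K]_(n, r)).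

Definition scale (c : K) x : ext_power K r n := [ffun I => c * x I].

Lemma incr_ltn I (i j : 'I_r) :
  (i < j)%N -> (tnth (val I) i < tnth (val I) j)%N.
Proof.
move=> ij; have := valP I; set s := [seq _ | _ <- _] => s_sorted.
have sE k : nth 0%N s (k : 'I_r) = tnth (val I) k.
  by rewrite (nth_map (tnth (val I) k)) ?size_tuple // -tnth_nth.
rewrite -!sE; apply: (sorted_ltn_nth ltn_trans) => //;
  by rewrite inE /s size_map size_tuple.
Qed.

Lemma incr_inj I : injective (tnth (val I)).
Proof.
move=> i j ij; apply/val_inj/eqP.
by case: ltngtP => // /(incr_ltn I); rewrite ij ltnn.
Qed.

Lemma incr_subset I J :
  (forall i, tnth (val I) i \in val J) -> I = J.
Proof.
move=> sIJ; apply/val_inj/val_inj.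
have uI : uniq (val I) by apply/tuple_uniqP/incr_inj.
have sub : {subset val I <= val J} by move=> _ /tnthP[i ->].
have sz : (size (val J) <= size (val I))%N by rewrite !size_tuple.
have [_ eIJ] := uniq_min_size uI sub sz.
apply: (inj_map val_inj); apply: (irr_sorted_eq ltn_trans ltnn) => [||k].
- exact: valP I.
- exact: valP J.
- by apply/mapP/mapP => -[i Ii ->]; exists i; rewrite ?eIJ // -eIJ.
Qed.

Lemma peval_scale d (f : coord_poly K r n) c x :
  f \is d.-homog -> peval f (scale c x) = c ^+ d * peval f x.
Proof.
move=> fd; rewrite /peval !mevalE mulr_sumr; apply: eq_big_seq => m mf.
rewrite (eq_bigr (fun i => c ^+ m i * x (enum_val i) ^+ m i)) => [|i _].
  rewrite big_split /= prodrXr -mdegE (dhomogP _ _ _ fd) //.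
  by rewrite mulrCA.
by rewrite ffunE exprMn.
Qed.

Lemma peval_coord I x : peval 'X_(enum_rank I) x = x I.
Proof. by rewrite /peval mevalXU enum_rankK. Qed.

Lemma pluecker_mulmx M (C : 'M_r) : pluecker (M *m C) = scale (\det C) (pluecker M).
Proof.
by apply/ffunP => I; rewrite !ffunE -mul_rowsub_mx det_mulmx mulrC.
Qed.

Lemma minor_neq0_rank M (f : 'I_r -> 'I_n) :
  \det (rowsub f M) != 0 -> \rank M = r.
Proof.
move=> d0; apply/eqP; rewrite eqn_leq rank_leq_col /=.
have : \rank (rowsub f M) = r by apply: mxrank_unit; rewrite unitmxE unitfE.
by move=> {1}<-; rewrite rowsubE; apply: mxrankM_maxr.
Qed.

(** Conditions on Pluecker coordinates thus carry over to minors whose rows are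
    listed in any order, as they arise from a choice of independent rows. *)
Lemma det_rowsub_sort M (f : 'I_r -> 'I_n) : injective f ->
  exists I (s : 'S_r), (forall i, tnth (val I) (s i) = f i) /\
    \det (rowsub f M) = (-1) ^+ s * pluecker M I.
Proof.
move=> f_inj; pose t : r.-tuple 'I_n := [tuple f i | i < r].
pose leI := [rel i j : 'I_n | (i <= j)%N].
have t_sorted : sorted ltn [seq val i | i <- sort_tuple leI t].
  rewrite ltn_sorted_uniq_leq map_inj_uniq; last exact: val_inj.
  rewrite sort_uniq sorted_map sort_sorted ?andbT; last first.
    by move=> i j /=; exact: leq_total.
  by apply/tuple_uniqP => i j; rewrite !tnth_mktuple; exact: f_inj.
have /tuple_permP[s st] : perm_eq t (sort_tuple leI t) by rewrite perm_sym perm_sort.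
pose I : incr r n := exist _ (sort_tuple leI t) t_sorted.
have Is i : tnth (val I) (s i) = f i.
  have /val_inj te : val t = val [tuple tnth (sort_tuple leI t) (s i) | i < r] by [].
  by have := congr1 (@tnth _ _ ^~ i) te; rewrite !tnth_mktuple.
exists I, s; split=> //; rewrite ffunE -det_perm -det_mulmx -row_permE.
by congr determinant; apply/matrixP => i j; rewrite !mxE Is.
Qed.

Lemma pluecker_ept w I : ept K (val w) I = (I == w)%:R.
Proof.
rewrite ffunE; have [->|Iw] := eqVneq I w.
  rewrite -[RHS](det1 K r); congr determinant; apply/matrixP => i j.
  by rewrite !mxE (inj_eq (@incr_inj w)).
have [i Ii] : exists i, tnth (val I) i \notin val w.
  apply/existsP; move: Iw; apply: contraR; rewrite negb_exists => /forallP h.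
  by apply/eqP/incr_subset => i; rewrite -[_ \in _]negbK; exact: h.
rewrite (expand_det_row _ i) big1 // => j _; rewrite !mxE.
by case: eqP => [e|_]; [rewrite e mem_tnth in Ii|rewrite mul0r].
Qed.

Lemma ext_act_ept (h : 'M_n) w I :
  ext_act h (ept K (val w)) I = \det (mxsub (tnth (val I)) (tnth (val w)) h).
Proof.
rewrite ffunE (bigD1 w) //= big1 => [|J /negbTE Jw].
  by rewrite addr0 pluecker_ept eqxx mulr1.
by rewrite pluecker_ept Jw mulr0.
Qed.

Lemma ext_act_diag (t : 'rV_n) x I :
  ext_act (diag_mx t) x I = (\prod_i t 0 (tnth (val I) i)) * x I.
Proof.
have minorE J : \det (mxsub (tnth (val I)) (tnth (val J)) (diag_mx t)) =
    (\prod_i t 0 (tnth (val I) i)) * (I == J)%:R.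
  rewrite -pluecker_ept ffunE -[\prod_i _](_ : \det (diag_mx (\row_i t 0 (tnth (val I) i))) = _).
    rewrite -det_mulmx; congr determinant; apply/matrixP => i j.
    by rewrite mul_diag_mx !mxE mulr_natr.
  by rewrite det_diag; apply: eq_bigr => i _; rewrite mxE.
rewrite ffunE (bigD1 I) //= big1 => [|J /negbTE JI].
  by rewrite minorE eqxx addr0 mulr1.
by rewrite minorE eq_sym JI mulr0 mul0r.
Qed.

Lemma pluecker_diag (t : 'rV_n) M :
  pluecker (diag_mx t *m M) = ext_act (diag_mx t) (pluecker M).
Proof.
apply/ffunP => I; rewrite ext_act_diag !ffunE.
rewrite [\prod_i _](_ : _ = \det (diag_mx (\row_i t 0 (tnth (val I) i)))).
  rewrite -det_mulmx; congr determinant; apply/matrixP => i j.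
  by rewrite !mul_diag_mx !mxE.
by rewrite det_diag; apply: eq_bigr => i _; rewrite mxE.
Qed.

Lemma ext_actZ c (h : 'M_n) x : ext_act (c *: h) x = scale (c ^+ r) (ext_act h x).
Proof.
apply/ffunP => I; rewrite !ffunE mulr_sumr; apply: eq_bigr => J _.
by rewrite mulrA -detZ; congr (_ * _); congr determinant; apply/matrixP => i j; rewrite !mxE.
Qed.

(** This turns the limit [e -> 0] along a line of matrices into the evaluation
    of a polynomial at 0, so that no topology is needed. *)
Lemma pluecker_line (f : coord_poly K r n) (A B : 'M[K]_(n, r)) :
  exists q : {poly K}, forall e, q.[e] = peval f (pluecker (A + e *: B)).
Proof.
pose N : 'M[{poly K}]_(n, r) := \matrix_(i, j) ((A i j)%:P + 'X * (B i j)%:P).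
pose x (i : 'I_#|incr r n|) : {poly K} := \det (rowsub (tnth (val (enum_val i))) N).
have xE e i : (x i).[e] = pluecker (A + e *: B) (enum_val i).
  rewrite ffunE -[LHS]/(horner_eval e _) -det_map_mx; congr determinant.
  by apply/matrixP => a b; rewrite !mxE /= horner_evalE !hornerE.
exists (mmap polyC x f) => e.
rewrite /peval mevalE /mmap horner_sum; apply: eq_bigr => m _.
rewrite hornerM hornerC /mmap1 horner_prod; congr (_ * _).
by apply: eq_bigr => i _; rewrite horner_exp xE.
Qed.

End Pluecker.

(** * Schubert varieties *)

Section Schubert.
Variables (K : fieldType) (r n : nat).
Implicit Types (I w : incr r n) (x : ext_power K r n).

Lemma zclosure_coord (S : set (ext_power K r n)) I x :
  (forall y, S y -> y I = 0) -> zclosure S x -> x I = 0.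
Proof.
move=> SI [_ /(_ 1%N 'X_(enum_rank I))].
rewrite !peval_coord; apply=> [|y Sy].
  by rewrite dhomogX; apply/eqP/mdeg1.
by rewrite peval_coord SI.
Qed.

(** The coordinate [I] of [b . e_w] is the minor of [b] in rows [I] and columns [w].
    Its rows from [k] on lie below the diagonal of [b] in the columns up to [k]. *)
Lemma schubert_coord_eq0 w I (k : 'I_r) x :
  schubert (val w) x -> (tnth (val w) k < tnth (val I) k)%N -> x I = 0.
Proof.
move=> Xx wI; apply: zclosure_coord Xx => _ [b [c [[b_trig _] _ ->]]].
rewrite ffunE ext_act_ept (@det_zero_block _ _ _ k) ?mulr0 // => i j ki jk.
have {}b_trig (u v : 'I_n) : (v < u)%N -> b u v = 0.
  by move=> uv; have := is_trig_mxP b_trig _ _ uv; rewrite mxE.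
rewrite mxE b_trig //; apply: leq_ltn_trans (leq_trans wI _).
  by case: (ltngtP j k) jk => // [/(incr_ltn w)/ltnW //|/val_inj-> _].
by case: (ltngtP k i) ki => // [/(incr_ltn I)/ltnW //|/val_inj-> _].
Qed.

Lemma opp_schubert_coord_eq0 w I (k : 'I_r) x :
  opp_schubert (val w) x -> (tnth (val I) k < tnth (val w) k)%N -> x I = 0.
Proof.
move=> Xx wI; apply: zclosure_coord Xx => _ [b [c [[b_trig _] _ ->]]].
rewrite ffunE ext_act_ept -det_tr (@det_zero_block _ _ _ k) ?mulr0 // => i j ki jk.
rewrite !mxE (is_trig_mxP b_trig) //; apply: leq_ltn_trans (leq_trans wI _).
  by case: (ltngtP j k) jk => // [/(incr_ltn I)/ltnW //|/val_inj-> _].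
by case: (ltngtP k i) ki => // [/(incr_ltn w)/ltnW //|/val_inj-> _].
Qed.

End Schubert.

(** * Points of Schubert varieties and of torus orbits *)

Section Orbits.
Variables (K : closedFieldType) (r n : nat).
Hypothesis n_gt0 : (0 < n)%N.
Implicit Types (I w : incr r n) (x : ext_power K r n) (M : 'M[K]_(n, r)).

Lemma closed_nth_root d (c : K) :
  (0 < d)%N -> c != 0 -> exists2 b, b != 0 & b ^+ d = c.
Proof.
move=> d_gt0 c0.
have [b bE] := solve_monicpoly (fun i => if i is 0 then c else 0) d_gt0.
have {}bE : b ^+ d = c.
  rewrite bE; case: d d_gt0 {bE} => // d _.
  by rewrite big_ord_recl expr0 mulr1 big1 ?addr0 // => i _; rewrite mul0r.
exists b => //; apply: contraNneq c0 => b0.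
by rewrite -bE b0 expr0n eqn0Ngt d_gt0.
Qed.

(** Over a closed field, [det h = 1] can always be reached by a scalar, which
    acts on the exterior power by a scalar. *)
Lemma unimodular_scale (h : 'M[K]_n) : \det h != 0 ->
  exists d, [/\ d != 0, \det (d *: h) = 1 &
    forall x, ext_act h x = scale (d ^- r) (ext_act (d *: h) x)].
Proof.
move=> h0; have [d d0 dE] := closed_nth_root n_gt0 (invr_neq0 h0).
exists d; split=> // [|x]; first by rewrite detZ dE mulVf.
by rewrite ext_actZ; apply/ffunP => I; rewrite !ffunE mulKf // expf_neq0.
Qed.

(** The columns of [M] in the positions [w], and those of the identity matrix
    elsewhere. *)
Definition insert_columns w M : 'M[K]_n :=
  \matrix_(i, j) if [pick k | tnth (val w) k == j] is Some k then M i k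
                 else (i == j)%:R.

Lemma insert_columnsE w M i k : insert_columns w M i (tnth (val w) k) = M i k.
Proof.
rewrite mxE; case: pickP => [k' /eqP/incr_inj -> //|/(_ k)].
by rewrite eqxx.
Qed.

(** An element [h] of [H] maps [e_w] to the wedge of its columns [w]. *)
Lemma orbit_insert_columns (H : set 'M[K]_n) w M :
  \det (insert_columns w M) != 0 ->
  (forall d, \det (d *: insert_columns w M) = 1 -> H (d *: insert_columns w M)) ->
  orbit_cone H (ept K (val w)) (pluecker M).
Proof.
move=> h0 Hh; have [d [d0 /Hh dH hE]] := unimodular_scale h0.
exists (d *: insert_columns w M), (d ^- r); split=> //.
  by rewrite invr_eq0 expf_neq0.
apply: etrans (hE _); apply/ffunP => I; rewrite ext_act_ept ffunE.
by congr determinant; apply/matrixP => i k; rewrite [RHS]mxE insert_columnsE !mxE.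
Qed.

Lemma borel_orbit w M :
  (forall (i : 'I_n) k, (tnth (val w) k < i)%N -> M i k = 0) ->
  (forall k, M (tnth (val w) k) k != 0) ->
  orbit_cone (@borel K n) (ept K (val w)) (pluecker M).
Proof.
move=> M0 Mw.
have trig : is_trig_mx (insert_columns w M)^T.
  apply/is_trig_mxP => j i ji; rewrite !mxE.
  case: pickP => [k /eqP kj|_]; first by rewrite M0 // kj.
  by rewrite -val_eqE gtn_eqF.
apply: orbit_insert_columns => [|d d1].
  rewrite -det_tr det_trig //; apply/prodf_neq0 => j _; rewrite !mxE.
  by case: pickP => [k /eqP <-|_]; rewrite ?eqxx ?oner_neq0.
split=> //; apply/is_trig_mxP => i j ij.
by have := is_trig_mxP trig _ _ ij; rewrite !mxE => ->; rewrite mulr0.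
Qed.

Lemma opp_borel_orbit w M :
  (forall (i : 'I_n) k, (i < tnth (val w) k)%N -> M i k = 0) ->
  (forall k, M (tnth (val w) k) k != 0) ->
  orbit_cone (@opp_borel K n) (ept K (val w)) (pluecker M).
Proof.
move=> M0 Mw.
have trig : is_trig_mx (insert_columns w M).
  apply/is_trig_mxP => i j ij; rewrite !mxE.
  case: pickP => [k /eqP kj|_]; first by rewrite M0 // kj.
  by rewrite -val_eqE ltn_eqF.
apply: orbit_insert_columns => [|d d1].
  rewrite det_trig //; apply/prodf_neq0 => j _; rewrite !mxE.
  by case: pickP => [k /eqP <-|_]; rewrite ?eqxx ?oner_neq0.
split=> //; apply/is_trig_mxP => i j ij.
by have := is_trig_mxP trig _ _ ij; rewrite !mxE => ->; rewrite mulr0.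
Qed.

Lemma rank_upper w M :
  (forall (i : 'I_n) k, (tnth (val w) k < i)%N -> M i k = 0) ->
  (forall k, M (tnth (val w) k) k != 0) -> \rank M = r.
Proof.
move=> M0 Mw; apply: (@minor_neq0_rank _ _ _ _ (tnth (val w))).
rewrite -det_tr det_trig; last first.
  by apply/is_trig_mxP => i j /(incr_ltn w) ij; rewrite !mxE M0.
by apply/prodf_neq0 => k _; rewrite !mxE.
Qed.

Lemma zclosure_pluecker (S : set (ext_power K r n)) M :
  \rank M = r -> S (pluecker M) -> zclosure S (pluecker M).
Proof. by move=> rM SM; split=> [|d f _]; [exists M|exact]. Qed.

Lemma torus_orbit_diag (t : 'rV[K]_n) (c : K) x : (forall i, t 0 i != 0) -> c != 0 ->
  orbit_cone (@torus K n) x (scale c (ext_act (diag_mx t) x)).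
Proof.
move=> t0 c0; have td : \det (diag_mx t) != 0.
  by rewrite det_diag; apply/prodf_neq0 => i _.
have [d [d0 td1 tE]] := unimodular_scale td.
exists (d *: diag_mx t), (c * d ^- r); split.
- split=> //; apply/is_diag_mxP => i j ij.
  by rewrite !mxE -val_eqE (negbTE ij) mulr0.
- by rewrite mulf_neq0 // invr_eq0 expf_neq0.
- by rewrite tE; apply/ffunP => I; rewrite !ffunE mulrA.
Qed.

End Orbits.

(** * The quotient of a variety with a dense torus orbit *)

Section DenseOrbit.
Variables (K : closedFieldType) (r n : nat) (X : set (ext_power K r n)).

(** A nonempty principal open subset of the line is dense, as the field is
    infinite. *)
Lemma closed_poly_eq0 (p q : {poly K}) :
  q != 0 -> (forall c, q.[c] != 0 -> p.[c] = 0) -> p = 0.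
Proof.
move=> q0 pq; apply/eqP; rewrite -(mulIr_eq0 p (mulIf q0)).
apply: contraT => /closed_nonrootP[c]; rewrite rootE hornerM mulf_eq0 negb_or.
by case/andP=> /negP pc /pq/eqP.
Qed.

Lemma section_scale d (s : X -> K) (x y : X) c : sections d s -> c != 0 ->
  val y = scale c (val x) -> s y = c ^+ d * s x.
Proof.
move=> /(_ x)[e [f [g [fh gh gx sE]]]] c0 yE.
have gy : peval g (val y) = c ^+ e * peval g (val x) by rewrite yE (peval_scale _ _ gh).
rewrite (sE x gx) (sE y) gy ?mulf_neq0 ?expf_neq0 //.
rewrite yE (peval_scale _ _ fh) exprD.
by rewrite -[_ * peval f _]mulrA -mulf_div divff ?expf_neq0 // mul1r mulrA.
Qed.

Lemma section_poly d (f : coord_poly K r n) :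
  f \is d.-homog -> sections d (fun x : X => peval f (val x)).
Proof.
move=> fh x; exists 0, f, 1; split=> // [||y _]; first exact: dhomog1.
  by rewrite /peval meval1 oner_neq0.
by rewrite /peval meval1 divr1.
Qed.

(** Locally [s - t = (f * g' - f' * g) / (g * g')], and this numerator times
    [g * g'] is a form that vanishes wherever [s = t]. *)
Lemma section_dense d (s t : X -> K) (O : set (ext_power K r n)) :
  O `<=` X -> X `<=` zclosure O -> sections d s -> sections d t ->
  (forall x : X, O (val x) -> s x = t x) -> s = t.
Proof.
move=> OX XO ss st st_O; apply/funext => x.
have [e [f [g [fh gh gx sE]]]] := ss x; have [e' [f' [g' [fh' gh' gx' tE]]]] := st x.
have [_ clO] := XO _ (set_mem (valP x)).
have : peval ((f * g' - f' * g) * (g * g')) (val x) = 0.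
  apply: (clO ((e + d + e') + (e + e'))%N) => [|y Oy].
    apply: dhomogM; last exact: dhomogM.
    apply: rpredB; first exact: dhomogM.
    have -> : (e + d + e' = e' + d + e)%N by ring.
    exact: dhomogM.
  pose y' : X := SigSub (mem_set (OX _ Oy)).
  rewrite /peval !(mevalM, mevalB) -!/(peval _ _).
  have [->|gy] := eqVneq (peval g y) 0; first by rewrite mul0r mulr0.
  have [->|gy'] := eqVneq (peval g' y) 0; first by rewrite !mulr0.
  have := st_O y' Oy; rewrite (sE y' gy) (tE y' gy') => /eqP.
  by rewrite eqr_div // => /eqP ->; rewrite subrr mul0r.
rewrite /peval !(mevalM, mevalB) -!/(peval _ _) => /eqP.
rewrite !mulf_eq0 (negbTE gx) (negbTE gx') !orbF subr_eq0 => /eqP e0.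
by rewrite sE // tE //; apply/eqP; rewrite eqr_div // e0.
Qed.

Variables (d : nat) (x0 : ext_power K r n) (F : coord_poly K r n).
Hypothesis d_gt0 : (0 < d)%N.
Hypothesis orbit_sub : orbit_cone (@torus K n) x0 `<=` X.
Hypothesis orbit_dense : X `<=` zclosure (orbit_cone (@torus K n) x0).
Hypothesis F_homog : F \is d.-homog.
Hypothesis F_x0 : peval F x0 != 0.
Hypothesis F_inv : forall t x, torus t -> peval F (ext_act t x) = peval F x.

Lemma torus1 : torus (1%:M : 'M[K]_n).
Proof. by split; rewrite ?det1 ?scalar_mx_is_diag. Qed.

Lemma orbit_scale t c : torus t -> c != 0 -> X (scale c (ext_act t x0)).
Proof. by move=> tT c0; apply: orbit_sub; exists t, c. Qed.

Lemma ext_act1 (x : ext_power K r n) : ext_act 1%:M x = x.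
Proof.
apply/ffunP => I; rewrite -diag_const_mx ext_act_diag big1 ?mul1r // => i _.
by rewrite mxE.
Qed.

(** An invariant section is determined by its value at [x0]: on the orbit by
    invariance and homogeneity, and then everywhere by density. *)
Lemma git_ring_dense_orbit m (s : X -> K) :
  git_ring d m s <-> exists c, s = fun x => c * peval F (val x) ^+ m.
Proof.
have homogFm c : c *: F ^+ m \is (d * m).-homog by rewrite dhomogZ ?dhomogMn.
have FmE c x : c * peval F x ^+ m = peval (c *: F ^+ m) x.
  by rewrite /peval mevalZ rmorphXn.
split=> [[ss sT]|[c ->]]; last first.
  split=> [|t x y tT xy]; last by rewrite xy F_inv.
  have := section_poly (homogFm c).
  by congr sections; apply/funext => x; rewrite FmE.
have x0X : X x0.
  have := orbit_scale torus1 (oner_neq0 K); rewrite ext_act1.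
  by congr X; apply/ffunP => I; rewrite ffunE mul1r.
pose y0 : X := SigSub (mem_set x0X).
exists (s y0 / peval F x0 ^+ m).
apply: (section_dense orbit_sub orbit_dense ss) => [|x [t [c [tT c0 xE]]]].
  have := section_poly (homogFm (s y0 / peval F x0 ^+ m)).
  by congr sections; apply/funext => x; rewrite FmE.
have tX : X (ext_act t x0).
  have := orbit_scale tT (oner_neq0 K).
  by congr X; apply/ffunP => I; rewrite ffunE mul1r.
pose y : X := SigSub (mem_set tX).
have sy : s y = s y0 by exact: (sT t).
rewrite (section_scale ss c0 (x := y)) // sy xE (peval_scale _ _ F_homog) F_inv //.
by rewrite exprMn -exprM mulrCA divfK // expf_neq0.
Qed.

(** [F] is transcendental over [K] as a function on [X]: since [K] has [d]-th roots,
    [F] takes all nonzero values on the multiples of [x0]. *)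
Lemma git_quotient_dense_orbit : git_quotient_is_point X d.
Proof.
apply: (@Proj_monogenic_is_point _ _ (fun x : X => peval F (val x))) => [|p p0].
  exact: git_ring_dense_orbit.
apply: (@closed_poly_eq0 p 'X); first by rewrite polyX_eq0.
move=> c; rewrite hornerX => c0.
have [b b0 bE] := closed_nth_root d_gt0 (mulf_neq0 c0 (invr_neq0 F_x0)).
have := p0 (SigSub (mem_set (orbit_scale torus1 b0))).
by rewrite /= (peval_scale _ _ F_homog) F_inv ?bE ?divfK //; exact: torus1.
Qed.

End DenseOrbit.

(** * The band matrices *)

Section Band.
Variable K : closedFieldType.
Implicit Types (M W A : 'M[K]_(7, 3)).

(** Rows and columns are numbered from 0, so column [j] may use the letters
    [2 * j + 1], [2 * j + 2], [2 * j + 3]: the interval between the j-th letters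
    of [1,3,5] and [3,5,7]. *)
Definition in_band (i : 'I_7) (j : 'I_3) : bool := (2 * j <= i <= 2 * j + 2)%N.

Definition banded M := forall i j, ~~ in_band i j -> M i j = 0.

Definition full_band M := forall i j, (M i j != 0) = in_band i j.

Definition band_one : 'M[K]_(7, 3) := \matrix_(i, j) (in_band i j)%:R.

Lemma full_band_banded M : full_band M -> banded M.
Proof. by move=> fM i j; rewrite -fM negbK => /eqP. Qed.

(** Rows and columns form a tree with the nine entries of the band as edges, so the
    scaling factors can be found one after another, starting from the first column. *)
Lemma full_band_scaling M : full_band M ->
  exists (t : 'rV[K]_7) (d : 'rV[K]_3), [/\ forall i, t 0 i != 0,
    forall j, d 0 j != 0 & M = diag_mx t *m band_one *m diag_mx d].
Proof.
move=> fM; pose B i j := M (inord i) (inord j).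
have ME i j : M i j = B i j by rewrite /B !inord_val.
have fB i j : (i < 7)%N -> (j < 3)%N -> (2 * j <= i <= 2 * j + 2)%N -> B i j != 0.
  by move=> i7 j3 ij; rewrite fM /in_band !inordK.
(* Rows 2 and 4 meet two columns each; they determine the factors of the
   second and third columns. *)
pose d1 := B 2%N 1%N / B 2%N 0%N; pose d2 := B 4%N 2%N * d1 / B 4%N 1%N.
pose t := [:: B 0 0; B 1 0; B 2 0; B 3 1 / d1; B 4 1 / d1; B 5 2 / d2; B 6 2 / d2]%N.
pose d := [:: 1; d1; d2].
have d1_neq0 : d1 != 0 by rewrite mulf_neq0 ?invr_eq0 ?fB.
have d2_neq0 : d2 != 0 by rewrite !mulf_neq0 ?invr_eq0 ?fB.
exists (\row_i t`_i), (\row_j d`_j); split.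
- case=> [[|[|[|[|[|[|[|//]]]]]]] i7]; rewrite mxE /= ?mulf_neq0 ?invr_eq0 ?fB //.
- by case=> [[|[|[|//]]] j3]; rewrite mxE //= oner_neq0.
apply/matrixP => i j; rewrite mul_mx_diag mul_diag_mx !mxE.
have [ij|/(full_band_banded fM) ->] := boolP (in_band i j); last by rewrite mulr0 mul0r.
rewrite mulr1 ME.
have b20 := fB 2 0 isT isT isT; have b41 := fB 4 1 isT isT isT.
case: i ij => [[|[|[|[|[|[|[|//]]]]]]] i7]; case: j => [[|[|[|//]]] j3] //= _;
  rewrite ?mulr1 ?divfK //.
- by rewrite mulrC divfK.
- by rewrite mulrC /d2 [RHS]mulrA divfK // mulfK.
Qed.

Definition band_point : ext_power K 3 7 := pluecker band_one.

Lemma full_band_orbit M :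
  full_band M -> orbit_cone (@torus K 7) band_point (pluecker M).
Proof.
move=> /full_band_scaling[t [d [t0 d0 ->]]].
rewrite pluecker_mulmx pluecker_diag det_diag.
by apply: torus_orbit_diag => //; apply/prodf_neq0 => j _.
Qed.

(** The factor [c] of the cone over the orbit is absorbed by the first column. *)
Lemma orbit_full_band x : orbit_cone (@torus K 7) band_point x ->
  exists2 M, full_band M & x = pluecker M.
Proof.
move=> [t [c [[/diag_mxP[d tE] t1] c0 ->]]].
have d0 i : d 0 i != 0.
  move: (oner_neq0 K); rewrite -t1 tE det_diag; apply: contraNneq => di.
  by rewrite (bigD1 i) //= di mul0r.
pose e : 'rV[K]_3 := \row_j if j == 0 then c else 1.
exists (diag_mx d *m band_one *m diag_mx e) => [i j|].
  rewrite mul_mx_diag mul_diag_mx !mxE !mulf_eq0 (negbTE (d0 i)) /=.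
  by case: in_band; case: ifP; rewrite ?eqxx ?oner_eq0 ?(negbTE c0).
rewrite pluecker_mulmx pluecker_diag tE det_diag big_ord_recl mxE /=.
by rewrite big1 ?mulr1 // => j _; rewrite mxE.
Qed.

(** * The closure of the torus orbit *)

(** [M + e *: band_one] has no zero in the band for all but finitely many [e]. *)
Lemma banded_in_closure d (f : coord_poly K 3 7) M : f \is d.-homog ->
  (forall A, full_band A -> peval f (pluecker A) = 0) ->
  banded M -> peval f (pluecker M) = 0.
Proof.
move=> fh f0 bM; have [q qE] := pluecker_line f M band_one.
have q0 : q = 0.
  apply: (@closed_poly_eq0 _ _ (\prod_i \prod_(j | in_band i j) ('X + (M i j)%:P))).
    apply/prodf_neq0 => i _; apply/prodf_neq0 => j _.
    by rewrite -[M i j]opprK polyCN polyXsubC_eq0.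
  move=> e; rewrite horner_prod => /prodf_neq0 r0; rewrite qE f0 // => i j.
  have [ij|ij] := boolP (in_band i j); last first.
    by rewrite !mxE bM // (negbTE ij) mulr0 addr0 eqxx.
  have := r0 i isT; rewrite horner_prod => /prodf_neq0/(_ j ij).
  by rewrite !hornerE !mxE ij mulr1 addrC.
by have := qE 0; rewrite q0 horner0 scale0r addr0.
Qed.

(** Let [u], [z], [v] be the columns of [W].  If [z] has no component on the first
    two basis vectors and none on the last two, then [W] is banded.  If instead [u]
    is a multiple of [e_3], let [z'] be the component of [z] on the first two basis
    vectors.  Then [u + e *: z'] is still supported on the first interval, and
    subtracting it from [e *: z] clears the component [e *: z'] at the cost of a
    multiple of [e_3], which the band allows in the second column.  The last two
    basis vectors and [v] are treated in the same way.  These column operations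
    have determinant [e], so for [e != 0] the matrix with the perturbed columns [u]
    and [v] spans the same space as a banded one; it is [W] for [e = 0]. *)
Lemma degenerate_in_closure d (f : coord_poly K 3 7) W : f \is d.-homog ->
  (forall A, full_band A -> peval f (pluecker A) = 0) ->
  (forall i : 'I_7, (2 < i)%N -> W i 0 = 0) ->
  (forall i : 'I_7, (i < 4)%N -> W i 2 = 0) ->
  (forall i : 'I_7, (i < 2)%N -> W i 0 = 0) \/
    (forall i : 'I_7, (i < 2)%N -> W i 1 = 0) ->
  (forall i : 'I_7, (4 < i)%N -> W i 2 = 0) \/
    (forall i : 'I_7, (4 < i)%N -> W i 1 = 0) ->
  peval f (pluecker W) = 0.
Proof.
move=> fh f0 W0 W2 Wlow Whigh.
(* [s] and [t] record whether the left and the right side are degenerate. *)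
have [s sE] : exists s : K, forall i : 'I_7, (i < 2)%N ->
    s * W i 0 = 0 /\ W i 1 - s * (s * W i 1) = 0.
  by case: Wlow => h; [exists 1|exists 0] => i /h ->;
    rewrite ?mul1r ?mul0r ?mulr0 ?subrr.
have [t tE] : exists t : K, forall i : 'I_7, (4 < i)%N ->
    t * W i 2 = 0 /\ W i 1 - t * (t * W i 1) = 0.
  by case: Whigh => h; [exists 1|exists 0] => i /h ->;
    rewrite ?mul1r ?mul0r ?mulr0 ?subrr.
pose Z : 'M[K]_(7, 3) := \matrix_(i, j)
  if (j == 0) && (i < 2)%N then s * W i 1 else
  if (j == 2) && (4 < i)%N then t * W i 1 else 0.
pose C e : 'M[K]_3 := \matrix_(i, j)
  if (i == 1) && (j == 1) then e else if i == j then 1 else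
  if j == 1 then (if i == 0 then - s else - t) else 0.
have detC e : \det (C e) = e by rewrite det_mx33 !mxE /=; ring.
have [q qE] := pluecker_line f W Z.
have q0 : q = 0.
  apply: (@closed_poly_eq0 _ _ 'X); first by rewrite polyX_eq0.
  move=> e; rewrite hornerX => e0; rewrite qE.
  have : peval f (pluecker ((W + e *: Z) *m C e)) = 0.
    apply: (banded_in_closure fh f0) => i j.
    rewrite mxE !big_ord_recl big_ord0 !mxE.
    have -> : lift ord0 (lift ord0 ord0) = 2 :> 'I_3 by exact: val_inj.
    have -> : lift ord0 ord0 = 1 :> 'I_3 by exact: val_inj.
    case: j => [[|[|[|//]]] j3]; rewrite /in_band /= ?mulr1 ?mulr0 ?addr0 ?add0r => ij;
      have i7 := ltn_ord i.
    + rewrite W0; last by lia.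
      by case: ifP => [|_]; [lia|rewrite mulr0 addr0].
    + have [i2|i2] := ltnP i 2.
        have [sW0 sW1] := sE i i2.
        rewrite W2; last by lia.
        case: ifP => [|_]; first by lia.
        transitivity (e * (W i 1 - s * (s * W i 1)) - s * W i 0); first by ring.
        by rewrite sW0 sW1; ring.
      have i4 : (4 < i)%N by lia.
      have [tW0 tW1] := tE i i4.
      rewrite W0 ?i4; last by lia.
      transitivity (e * (W i 1 - t * (t * W i 1)) - t * W i 2); first by ring.
      by rewrite tW0 tW1; ring.
    + rewrite W2; last by lia.
      by case: ifP => [|_]; [lia|rewrite mulr0 addr0].
  rewrite pluecker_mulmx detC (peval_scale _ _ fh) => /eqP.
  by rewrite mulf_eq0 expf_eq0 (negbTE e0) andbF => /eqP.
by have := qE 0; rewrite q0 horner0 scale0r addr0.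
Qed.

End Band.

(** * The Richardson variety *)

Lemma letter_val k : (0 < k <= 7)%N -> val (letter k) = k.-1.
Proof. by case: k => // k; exact: inordK. Qed.

Lemma triple_sorted i j k : [&& 0 < i, i < j, j < k & k <= 7]%N ->
  sorted ltn [seq val l | l <- [tuple letter i; letter j; letter k]].
Proof. by move=> h; rewrite /= !letter_val; lia. Qed.

(** Letters are numbered from 1, as in the notation for cosets. *)
Definition triple i j k (h : [&& 0 < i, i < j, j < k & k <= 7]%N) : incr 3 7 :=
  exist _ [tuple letter i; letter j; letter k] (triple_sorted h).

Section Richardson.
Variable K : closedFieldType.
Implicit Types (M W A : 'M[K]_(7, 3)).

Let X := richardson K (coset_word v_perm) w37.

Lemma w37_val (m : 'I_3) : tnth w37 m = (2 * m + 2)%N :> nat.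
Proof. by case: m => [[|[|[|//]]] m3]; rewrite (tnth_nth (letter 1)) /= inordK. Qed.

Lemma v135_val (m : 'I_3) :
  tnth (val (@triple 1 3 5 isT)) m = (2 * m)%N :> nat.
Proof. by case: m => [[|[|[|//]]] m3]; rewrite (tnth_nth (letter 1)) /= inordK. Qed.

Lemma richardson_coord_eq0 x (I : incr 3 7) m :
  X x -> ~~ in_band (tnth (val I) m) m -> x I = 0.
Proof.
move=> [xw]; rewrite coset_word_v_perm => xv; rewrite negb_and -!ltnNge => /orP[lo|hi].
  by apply: (@opp_schubert_coord_eq0 _ _ _ (@triple 1 3 5 isT) _ m) => //; rewrite v135_val.
by apply: (@schubert_coord_eq0 _ _ _ (@triple 3 5 7 isT) _ m) => //; rewrite w37_val.
Qed.

(** [M] provides the columns 3, 5, 7 of an upper triangular matrix and the columns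
    1, 3, 5 of a lower triangular one, with nonzero diagonal entries since these
    positions are the two ends of the band. *)
Lemma full_band_richardson M : full_band M -> X (pluecker M).
Proof.
move=> fM; have bM := full_band_banded fM.
have w0 (i : 'I_7) (k : 'I_3) :
    (tnth (val (@triple 3 5 7 isT)) k < i)%N -> M i k = 0.
  by rewrite w37_val => ki; rewrite bM // /in_band; lia.
have wk k : M (tnth (val (@triple 3 5 7 isT)) k) k != 0.
  by rewrite fM /in_band w37_val; lia.
have rM := rank_upper w0 wk.
split; apply: zclosure_pluecker => //; first exact: borel_orbit w0 wk.
rewrite coset_word_v_perm; apply: (@opp_borel_orbit _ _ _ _ (@triple 1 3 5 isT)) => // [i k|k].
  by rewrite v135_val => ki; rewrite bM // /in_band; lia.
by rewrite fM /in_band v135_val; lia.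
Qed.

Lemma minor_triple M i j k h :
  pluecker M (@triple i j k h) =
    \det (\matrix_(a < 3, b < 3) M (tnth [tuple letter i; letter j; letter k] a) b).
Proof. by rewrite ffunE; congr determinant; apply/matrixP => a b; rewrite !mxE. Qed.

Lemma minor_col_left M i j k h : M (letter i) 2 = 0 -> M (letter j) 2 = 0 ->
  pluecker M (@triple i j k h) = (M (letter i) 0 * M (letter j) 1 -
    M (letter i) 1 * M (letter j) 0) * M (letter k) 2.
Proof.
move=> i2 j2; rewrite minor_triple det_mx33 !mxE !(tnth_nth (letter 1)) /= i2 j2.
ring.
Qed.

Lemma minor_col_right M i j k h : M (letter j) 0 = 0 -> M (letter k) 0 = 0 ->
  pluecker M (@triple i j k h) = M (letter i) 0 * (M (letter j) 1 * M (letter k) 2 -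
    M (letter j) 2 * M (letter k) 1).
Proof.
move=> j0 k0; rewrite minor_triple det_mx33 !mxE !(tnth_nth (letter 1)) /= j0 k0.
ring.
Qed.

(** After sorting, the smallest row index is out of the band of the first column. *)
Lemma richardson_minor_high M (f : 'I_3 -> 'I_7) : X (pluecker M) ->
  injective f -> (forall i, 2 < f i)%N -> \det (rowsub f M) = 0.
Proof.
move=> XM f_inj f2; have [I [s [Is ->]]] := det_rowsub_sort M f_inj.
rewrite (richardson_coord_eq0 (m := 0) XM) ?mulr0 //.
have := f2 (s^-1%g 0); rewrite -Is permKV /in_band /=; lia.
Qed.

(** After sorting, the largest row index is out of the band of the last column. *)
Lemma richardson_minor_low M (f : 'I_3 -> 'I_7) : X (pluecker M) ->
  injective f -> (forall i, f i < 4)%N -> \det (rowsub f M) = 0.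
Proof.
move=> XM f_inj f4; have [I [s [Is ->]]] := det_rowsub_sort M f_inj.
rewrite (richardson_coord_eq0 (m := 2) XM) ?mulr0 //.
by have := f4 (s^-1%g 2); rewrite -Is permKV negb_and -ltnNge => ->.
Qed.

Lemma rank3_mul_eq0 M (c : 'cV_3) : \rank M = 3 -> M *m c = 0 -> c = 0.
Proof.
move=> rM Mc; apply: trmx_inj; rewrite trmx0.
have : row_free M^T by rewrite /row_free mxrank_tr rM.
by move/row_free_inj; apply; rewrite -trmx_mul Mc trmx0 mul0mx.
Qed.

(** The space meets <e_1, e_2, e_3> and <e_5, e_6, e_7> in nonzero vectors [u] and [v],
    because the minors on rows 4 to 7 and on rows 1 to 4 vanish.  Complete [u], [v] to a
    basis by [z].  As [v] has a nonzero entry in some row [k > 4], the vanishing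
    coordinate 1, 2, [k] shows that [u] and [z] are proportional in rows 1 and 2; so
    either [u] vanishes there, or a multiple of [u] can be subtracted from [z] to make
    [z] vanish there.  The coordinate [i], 6, 7, with [u] nonzero in row [i], gives the
    same for [v] and [z]. *)
Lemma richardson_basis M : X (pluecker M) -> \rank M = 3 ->
  exists2 C : 'M[K]_3, \det C != 0 & let W := M *m C in
  [/\ forall i : 'I_7, (2 < i)%N -> W i 0 = 0,
      forall i : 'I_7, (i < 4)%N -> W i 2 = 0,
      (forall i : 'I_7, (i < 2)%N -> W i 0 = 0) \/
        (forall i : 'I_7, (i < 2)%N -> W i 1 = 0) &
      (forall i : 'I_7, (4 < i)%N -> W i 2 = 0) \/
        (forall i : 'I_7, (4 < i)%N -> W i 1 = 0)].
Proof.
move=> XM rM.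
have [a a0 Ma] : exists2 a : 'cV_3, a != 0 & forall i : 'I_7, (2 < i)%N -> (M *m a) i 0 = 0.
  have [|a a0 Ma] := @minors_eq0_kernel _ _ _ (rowsub (@rshift 3 4) M).
    move=> g g_inj; rewrite -rowsub_comp; apply: richardson_minor_high => //.
    exact: inj_comp (@rshift_inj 3 4) g_inj.
  exists a => // i i2; have i4 : (i - 3 < 4)%N by have := ltn_ord i; lia.
  have -> : i = rshift 3 (Ordinal i4) by apply: val_inj; rewrite /=; lia.
  by have := congr1 (fun A : 'cV_4 => A (Ordinal i4) 0) Ma; rewrite mul_rowsub_mx !mxE.
have [b b0 Mb] : exists2 b : 'cV_3, b != 0 & forall i : 'I_7, (i < 4)%N -> (M *m b) i 0 = 0.
  have [|b b0 Mb] := @minors_eq0_kernel _ _ _ (rowsub (@lshift 4 3) M).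
    move=> g g_inj; rewrite -rowsub_comp; apply: richardson_minor_low => //=.
    exact: inj_comp (@lshift_inj 4 3) g_inj.
  exists b => // i i4.
  have -> : i = lshift 3 (Ordinal i4) by exact: val_inj.
  by have := congr1 (fun A : 'cV_4 => A (Ordinal i4) 0) Mb; rewrite mul_rowsub_mx !mxE.
pose C (c : 'cV[K]_3) : 'M[K]_3 := \matrix_(i, j) [tuple a i 0; c i 0; b i 0]`_j.
have [c Cc] : exists c, \det (C c) != 0.
  apply: contrapT => nC.
  have cross := @cross_eq0 _ a b (fun c => contrapT (fun h => nC (ex_intro _ c (introN eqP h)))).
  (* Otherwise [b] is a multiple of [a], and [M *m b] is zero in all rows. *)
  have /cV0Pn[i ai] := a0.
  have bE : b = (b i 0 / a i 0) *: a.
    apply/matrixP => j k; rewrite ord1 mxE mulrAC [b i 0 * _]mulrC.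
    by rewrite (cross j i) mulrAC mulfV // mul1r.
  move/eqP: b0; apply; apply: (rank3_mul_eq0 rM).
  apply/matrixP => k l; rewrite ord1 [RHS]mxE; have [k4|k4] := ltnP k 4; first exact: Mb.
  by rewrite bE -scalemxAr mxE Ma ?mulr0 //; exact: ltnW.
have WE c' i : [/\ (M *m C c') i 0 = (M *m a) i 0, (M *m C c') i 1 = (M *m c') i 0 &
    (M *m C c') i 2 = (M *m b) i 0].
  by split; rewrite !mxE; apply: eq_bigr => k _; rewrite mxE.
have minor0 (I : incr 3 7) m : ~~ in_band (tnth (val I) m) m ->
    pluecker (M *m C c) I = 0.
  by move=> Im; rewrite pluecker_mulmx ffunE (richardson_coord_eq0 XM Im) mulr0.
have letterS (k : 'I_7) : letter k.+1 = k
  by apply: val_inj; rewrite letter_val //=; exact: ltn_ord.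
have [l lE] : exists l, (forall i : 'I_7, (i < 2)%N -> (M *m a) i 0 = 0) \/
    (forall i : 'I_7, (i < 2)%N -> (M *m c) i 0 - l * (M *m a) i 0 = 0).
  have /cV0Pn[k bk] : M *m b != 0 by apply: contra_neq b0; exact: rank3_mul_eq0.
  have k4 : (4 <= k)%N by rewrite leqNgt; apply: contra bk => /Mb/eqP.
  have h : [&& 0 < 1, 1 < 2, 2 < k.+1 & k.+1 <= 7]%N by have := ltn_ord k; lia.
  have := minor0 (triple h) 1; rewrite minor_col_left; first last.
  - by have [_ _ ->] := WE c (letter 2); rewrite Mb // letter_val.
  - by have [_ _ ->] := WE c (letter 1); rewrite Mb // letter_val.
  rewrite (tnth_nth (letter 1)) /in_band /= letter_val // => /(_ isT)/eqP.
  have [-> -> _] := WE c (letter 1); have [-> -> _] := WE c (letter 2).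
  have [_ _ ->] := WE c (letter k.+1); rewrite letterS mulf_eq0 (negbTE bk) orbF subr_eq0.
  rewrite [X in _ == X]mulrC => /eqP/parallel_elim[l lE]; exists l.
  have I2 (i : 'I_7) : (i < 2)%N -> i = letter 1 \/ i = letter 2.
    by case: i => [[|[|//]] i7] _; [left|right]; apply: val_inj; rewrite letter_val.
  by case: lE => -[h1 h2]; [left|right] => i /I2[] ->.
have [m mE] : exists m, (forall i : 'I_7, (4 < i)%N -> (M *m b) i 0 = 0) \/
    (forall i : 'I_7, (4 < i)%N -> (M *m c) i 0 - m * (M *m b) i 0 = 0).
  have /cV0Pn[k ak] : M *m a != 0 by apply: contra_neq a0; exact: rank3_mul_eq0.
  have k2 : (k <= 2)%N by rewrite leqNgt; apply: contra ak => /Ma/eqP.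
  have h : [&& 0 < k.+1, k.+1 < 6, 6 < 7 & 7 <= 7]%N by lia.
  have := minor0 (triple h) 1; rewrite minor_col_right; first last.
  - by have [-> _ _] := WE c (letter 7); rewrite Ma // letter_val.
  - by have [-> _ _] := WE c (letter 6); rewrite Ma // letter_val.
  rewrite (tnth_nth (letter 1)) /in_band /= letter_val // => /(_ isT)/eqP.
  have [_ -> ->] := WE c (letter 6); have [_ -> ->] := WE c (letter 7).
  have [-> _ _] := WE c (letter k.+1); rewrite letterS mulf_eq0 (negbTE ak) subr_eq0 /=.
  rewrite eq_sym [X in _ == X]mulrC => /eqP/parallel_elim[m mE]; exists m.
  have I6 (i : 'I_7) : (4 < i)%N -> i = letter 6 \/ i = letter 7.
    by case: i => [[|[|[|[|[|[|[|//]]]]]]] i7] // _; [left|right]; apply: val_inj; rewrite letter_val.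
  by case: mE => -[h1 h2]; [left|right] => i /I6[] ->.
pose c' := c - l *: a - m *: b.
exists (C c').
  rewrite (_ : \det (C c') = \det (C c)) // !det_mx33 !mxE /=.
  ring.
have McE i : (M *m c') i 0 = (M *m c) i 0 - l * (M *m a) i 0 - m * (M *m b) i 0.
  by rewrite !mulmxBr -!scalemxAr !mxE.
split.
- by move=> i; have [-> _ _] := WE c' i; exact: Ma.
- by move=> i; have [_ _ ->] := WE c' i; exact: Mb.
- case: lE => h; [left|right] => i i2.
    by have [-> _ _] := WE c' i; exact: h.
  by have [_ -> _] := WE c' i; rewrite McE h // Mb ?mulr0 ?subr0 //; lia.
- case: mE => h; [left|right] => i i4.
    by have [_ _ ->] := WE c' i; exact: h.
  by have [_ -> _] := WE c' i; rewrite McE addrAC h // Ma ?mulr0 ?subr0 //; lia.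
Qed.

Lemma richardson_torus_dense : X `<=` zclosure (orbit_cone (@torus K 7) (band_point K)).
Proof.
move=> x Xx; have [M rM xM] : grassmannian x by case: Xx => [[]].
split=> [|d f fh f0]; first by exists M.
rewrite {x}xM in Xx *; have [C C0 [W0 W2 Wlow Whigh]] := richardson_basis Xx rM.
have f0' A : full_band A -> peval f (pluecker A) = 0.
  by move=> fA; apply/f0/full_band_orbit.
have := degenerate_in_closure fh f0' W0 W2 Wlow Whigh.
rewrite pluecker_mulmx (peval_scale _ _ fh) => /eqP.
by rewrite mulf_eq0 expf_eq0 (negbTE C0) andbF => /eqP.
Qed.

Lemma torus_orbit_sub_richardson : orbit_cone (@torus K 7) (band_point K) `<=` X.
Proof. by move=> x /orbit_full_band[M fM ->]; exact: full_band_richardson. Qed.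

(** * The invariant form *)

(** These are the rows of the only semistandard tableau with 7 rows between 135 and 357
    in which each of 1, ..., 7 occurs three times: the first column must be
    1,1,1,2,2,2,3, which leaves 3,3,4,4,4,5,5 and 5,6,6,6,7,7,7 for the others. *)
Definition invariant_rows : seq (incr 3 7) :=
  [:: @triple 1 3 5 isT; @triple 1 3 6 isT; @triple 1 4 6 isT; @triple 2 4 6 isT;
      @triple 2 4 7 isT; @triple 2 5 7 isT; @triple 3 5 7 isT].

Definition invariant_form : coord_poly K 3 7 :=
  \prod_(I <- invariant_rows) 'X_(enum_rank I).

Lemma peval_invariant_form x : peval invariant_form x = \prod_(I <- invariant_rows) x I.
Proof.
by rewrite /peval rmorph_prod; apply: eq_bigr => I _; exact: peval_coord.
Qed.

Lemma invariant_form_homog : invariant_form \is 7.-homog.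
Proof.
rewrite /invariant_form /invariant_rows !big_cons big_nil.
do 7! [apply: (@dhomogM _ _ _ 1); first by rewrite dhomogX; apply/eqP/mdeg1].
exact: dhomog1.
Qed.

Lemma big_letters (f : 'I_7 -> K) : \prod_i f i =
  f (letter 1) * f (letter 2) * f (letter 3) * f (letter 4) * f (letter 5)
  * f (letter 6) * f (letter 7).
Proof.
rewrite !big_ord_recl big_ord0 mulr1 !mulrA.
by do ![congr (_ * _)|congr f]; apply: val_inj; rewrite letter_val.
Qed.

Lemma invariant_form_invariant t x :
  torus t -> peval invariant_form (ext_act t x) = peval invariant_form x.
Proof.
move=> [/diag_mxP[d ->]]; rewrite det_diag => d1; rewrite !peval_invariant_form.
under eq_bigr do rewrite ext_act_diag.
rewrite big_split /= -[RHS]mul1r; congr (_ * _).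
transitivity ((\prod_i d 0 i) ^+ 3); last by rewrite d1 expr1n.
rewrite big_letters /invariant_rows !big_cons big_nil.
rewrite !big_ord_recl !big_ord0 !(tnth_nth (letter 1)) /=.
ring.
Qed.

Lemma invariant_form_point : peval invariant_form (band_point K) != 0.
Proof.
pose b l m : K := (2 * m <= l.-1 <= 2 * m + 2)%N%:R.
have bandE i j k h : band_point K (@triple i j k h) =
    b i 0%N * (b j 1%N * b k 2%N - b j 2%N * b k 1%N)
    - b i 1%N * (b j 0%N * b k 2%N - b j 2%N * b k 0%N)
    + b i 2%N * (b j 0%N * b k 1%N - b j 1%N * b k 0%N).
  rewrite minor_triple det_mx33 !mxE !(tnth_nth (letter 1)) /in_band /=.
  by rewrite !letter_val //; lia.
rewrite peval_invariant_form /invariant_rows !big_cons big_nil !bandE /b /=.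
by rewrite !(mul0r, mulr0, mul1r, mulr1, subr0, addr0) oner_neq0.
Qed.

Lemma richardson_quotient_is_point : git_quotient_is_point X 7.
Proof.
apply: (git_quotient_dense_orbit (x0 := band_point K) (F := invariant_form)) => //.
- exact: torus_orbit_sub_richardson.
- exact: richardson_torus_dense.
- exact: invariant_form_homog.
- exact: invariant_form_point.
- exact: invariant_form_invariant.
Qed.

End Richardson.

Theorem lemma5p9 (R : realType) :
  git_quotient_is_point (richardson R[i]%C (coset_word v_perm) w37) 7.
Proof. exact: richardson_quotient_is_point. Qed.
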